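(* For each $\mathcal K\in\{\mathcal M,\mathcal G\}$ and each $\alpha\le\omega$, the classes $\mathcal K^{\mathrm{sep}}_{=\alpha}$, $\mathcal K^{\mathrm{sep}}_{\le\alpha}$ and $\mathcal K^{\mathrm{sep}}_{<\alpha}$ are amalgamation classes with modulus of stability $\varpi(d,l,\delta)=2\delta$. Furthermore, $\mathcal K_{<\omega}$ is an amalgamation class with the same modulus of stability.
   Context: $\omega=\{0,1,2,\dots\}$, $\mathbb N=\omega\setminus\{0\}$. A multi-seminormed space is a vector space $X$ with a sequence of seminorms $(\|\cdot\|_{X,n})_{n<\lambda_X}$, where $1\le\lambda_X\le\omega$ is its length. It is separated if for every $x\neq 0$ some $\|x\|_{X,n}\ne 0$ (this is not required in general), and graded if $\|x\|_{X,n}\le\|x\|_{X,m}$ for all $x$ and $n\le m<\lambda_X$. $\mathcal M$ is the class of finite-dimensional multi-seminormed spaces, and $\mathcal G$ is the class of graded members of $\mathcal M$. For a class $\mathcal K\subseteq\mathcal M$, $\mathcal K_{<\alpha},\mathcal K_{\le\alpha},\mathcal K_{=\alpha}$ are the subclasses of those $X\in\mathcal K$ with $\lambda_X<\alpha$, $\lambda_X\le\alpha$, $\lambda_X=\alpha$ respectively, and the superscript $\mathrm{sep}$ denotes the subclass of separated members. For $\delta\ge 0$, a multi-$\delta$-isometric embedding $f:X\to Y$ (where $\lambda_X\le\lambda_Y$) is an injective linear map such that $\frac1{1+\delta}\|x\|_{X,m}\le\|f(x)\|_{Y,m}\le(1+\delta)\|x\|_{X,m}$ for all $x\in X$, $m<\lambda_X$;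 for $\delta=0$ it is called a multi-isometric embedding. For linear $h:X\to Y$ and $n<\lambda_X\le\lambda_Y$, $\|h\|_n:=\sup\{\|h(x)\|_{Y,n}:\|x\|_{X,n}\le1\}$. A modulus is a function $\varpi:\mathbb N\times(\mathbb N\cup\{\omega\})\times[0,\infty[\,\to[0,\infty[$ such that each $\varpi(d,l,\cdot)$ is increasing and continuous at $0$ with value $0$. A class $\mathcal K$ of finite-dimensional multi-seminormed spaces is an amalgamation class with modulus of stability $\varpi$ if $(\{0\},\|\cdot\|)\in\mathcal K$ and for every $d\in\mathbb N$, $l\in\mathbb N\cup\{\omega\}$, $\varepsilon>0$ and $\delta\ge0$, every $X,Y,Z\in\mathcal K$ such that $\dim X=d$ and $\lambda_X=l$, and every pair of multi-$\delta$-isometric embeddings $f_0:X\to Y$, $f_1:X\to Z$, there is a separated $W\in\mathcal K$ together with multi-isometric embeddings $g_0:Y\to W$, $g_1:Z\to W$ such that $\|g_0\circ f_0-g_1\circ f_1\|_n\le\varpi(d,l,\delta)+\varepsilon$ for each $n<\lambda_X$. *)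

(* Defs.v *)
From HB Require Import structures.
From mathcomp Require Import all_boot all_order all_algebra.
From mathcomp Require Import complex.
From mathcomp Require Import all_classical all_reals all_analysis.

Set Implicit Arguments.
Unset Strict Implicit.
Unset Printing Implicit Defensive.

Import Order.TTheory GRing.Theory Num.Theory.
Import numFieldNormedType.Exports.

Local Open Scope classical_set_scope.
Local Open Scope ring_scope.

(* The ordinals at most omega. *)
Inductive ordw : Type := Fin of nat | Omega.

Coercion Fin : nat >-> ordw.

Definition ordw_le (a b : ordw) : bool :=
  match a, b with
  | _, Omega => true
  | Fin m, Fin n => (m <= n)%N
  | Omega, Fin _ => false
  end.

Definition ordw_lt (a b : ordw) : bool := ~~ ordw_le b a.

Inductive scalars : Type := RealScalars | ComplexScalars.

Definition scalar_field (R : realType) (s : scalars) : fieldType :=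
  match s with
  | RealScalars => R
  | ComplexScalars => complex R
  end.

Definition scalar_abs (R : realType) (s : scalars) : scalar_field R s -> R :=
  match s return scalar_field R s -> R with
  | RealScalars => fun a : R => `|a|
  | ComplexScalars => fun a : complex R => ComplexField.Normc.normc a
  end.

(* Nonnegativity, and value 0 at 0, follow from these two conditions. *)
Definition is_seminorm (R : realType) (s : scalars)
    (X : lmodType (scalar_field R s)) (p : X -> R) : Prop :=
  (forall x y, p (x + y) <= p x + p y) /\
  (forall a x, p (a *: x) = scalar_abs a * p x).

(* Finite-dimensional multi-seminormed spaces: a [vectType] is
   finite-dimensional, and may be zero.  Only the seminorms of index below
   [mslen] are part of the data; the values [msnorm n] for n >= mslen are
   irrelevant and never used. *)
Record mspace (R : realType) (s : scalars) : Type := MSpace {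
  mscarrier :> vectType (scalar_field R s);
  mslen : ordw;
  msnorm : nat -> mscarrier -> R;
  mslen_ge1 : ordw_le 1%N mslen;
  msnorm_seminorm : forall n : nat, ordw_lt n mslen -> is_seminorm (msnorm n)
}.

Arguments msnorm {R s} m n x.

(* A plain predicate: [set (mspace R s)] is rejected for universe reasons. *)
Definition msclass (R : realType) (s : scalars) : Type := mspace R s -> Prop.

Section MultiSeminormed.
Variables (R : realType) (s : scalars).
Implicit Types (X Y Z W : mspace R s) (K : msclass R s).

Definition separated X : Prop :=
  forall x : X, x != 0 ->
    exists2 n : nat, ordw_lt n (mslen X) & msnorm X n x != 0.

Definition graded X : Prop :=
  forall (x : X) (n m : nat), (n <= m)%N -> ordw_lt m (mslen X) ->
    msnorm X n x <= msnorm X m x.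

Definition classM : msclass R s := fun _ => True.
Definition classG : msclass R s := fun X => graded X.

Definition class_lt K (alpha : ordw) : msclass R s :=
  fun X => K X /\ ordw_lt (mslen X) alpha.
Definition class_le K (alpha : ordw) : msclass R s :=
  fun X => K X /\ ordw_le (mslen X) alpha.
Definition class_eq K (alpha : ordw) : msclass R s :=
  fun X => K X /\ mslen X = alpha.
Definition class_sep K : msclass R s := fun X => K X /\ separated X.

Definition multi_embedding (delta : R) X Y (f : 'Hom(X, Y)) : Prop :=
  [/\ ordw_le (mslen X) (mslen Y),
      injective f
    & forall (x : X) (m : nat), ordw_lt m (mslen X) ->
        (1 + delta)^-1 * msnorm X m x <= msnorm Y m (f x) /\
        msnorm Y m (f x) <= (1 + delta) * msnorm X m x].

Definition multi_isometric X Y (f : 'Hom(X, Y)) : Prop :=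
  multi_embedding 0 f.

(* The supremum is extended-real, as it may be infinite when msnorm X n is
   not a norm. *)
Definition opnorm X Y (n : nat) (h : 'Hom(X, Y)) : \bar R :=
  ereal_sup [set (msnorm Y n (h x))%:E | x in [set x : X | msnorm X n x <= 1]].

(* A modulus is a function on N_{>0} x (N_{>0} u {omega}) x [0, +oo[; its
   values elsewhere are irrelevant. *)
Definition is_modulus (w : nat -> ordw -> R -> R) : Prop :=
  forall (d : nat) (l : ordw), (1 <= d)%N -> ordw_le 1%N l ->
    [/\ forall t, 0 <= t -> 0 <= w d l t,
        forall t u, 0 <= t -> t < u -> w d l t < w d l u,
        w d l 0 = 0
      & w d l t @[t --> 0^'+] --> (0 : R)].

(* The zero space is required with some length, since the length it has to
   have depends on K. *)
Definition amalgamation_class K (w : nat -> ordw -> R -> R) : Prop :=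
  [/\ is_modulus w,
      exists2 O : mspace R s, K O & \dim {: O} = 0%N
    & forall (d : nat) (l : ordw) (eps delta : R),
        (1 <= d)%N -> ordw_le 1%N l -> 0 < eps -> 0 <= delta ->
      forall (X Y Z : mspace R s), K X -> K Y -> K Z ->
        \dim {: X} = d -> mslen X = l ->
      forall (f0 : 'Hom(X, Y)) (f1 : 'Hom(X, Z)),
        multi_embedding delta f0 -> multi_embedding delta f1 ->
      exists (W : mspace R s) (g0 : 'Hom(Y, W)) (g1 : 'Hom(Z, W)),
        [/\ K W, separated W, multi_isometric g0, multi_isometric g1
          & forall n : nat, ordw_lt n (mslen X) ->
              (opnorm n ((g0 \o f0)%VF - (g1 \o f1)%VF)%R <= (w d l delta + eps)%:E)%E]].

End MultiSeminormed.

Arguments classM {R s}.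
Arguments classG {R s}.

(* Main.v *)
Require Import Defs.
From HB Require Import structures.
From mathcomp Require Import all_boot all_order all_algebra.
From mathcomp Require Import all_classical all_reals all_analysis.
From mathcomp Require Import complex.
From mathcomp Require Import lra zify.

(** Given two multi-[delta]-isometric embeddings [f0 : X -> Y] and
    [f1 : X -> Z], the amalgam is the direct sum [Y * Z] in which [f0 x] and
    [f1 x] are pushed together: writing [c := 2 * delta + eps], its [n]-th
    seminorm is, for [n] below the length of [X], the infimal convolution
      [|(y, z)|_n := inf_x |y - f0 x|_n + |z + f1 x|_n + c |x|_n],
    and the plain sum [|y|_n + |z|_n] for the later [n].  Taking [x] itself as
    a competitor in the infimum bounds the [n]-th seminorm of
    [(f0 x, - f1 x)] by [c |x|_n], which is the required estimate
    ([amalgam_norm_gap]).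

    The inclusions of [Y] and [Z] stay isometric as soon as [2 * delta <= c].
    Indeed
      [|y| <= |y - f0 x| + |f0 x| <= |y - f0 x| + |f1 x| + 2 delta |x|],
    where the last step is [multi_embedding_compare]; it comes down to
    [(1 + delta) - 1 / (1 + delta) <= 2 delta].

    The strict inequality [0 < c] gives separation: since
    [|y| <= |y - f0 x| + (1 + delta) |x|], the seminorm [|y|_n] is at most a
    constant times [|(y, z)|_n], and likewise for [z]; so the amalgam is
    separated when [Y] and [Z] are ([amalgam_separated]).

    The amalgam has length the maximum of the lengths of [Y] and [Z].  Past the
    end of the shorter space its last seminorm is repeated, which makes the sums
    increase with [n] in the graded case.  Gradedness at the length of [X],
    where infima give way to sums, holds because an infimum is at most its
    term at [x = 0] ([amalgam_graded]).

    For spaces of finite length that need not be separated, [Y] and [Z] are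
    first lengthened by one seminorm, namely the last one plus a genuine norm
    ([sepext]).  This makes them separated, keeps them graded and of finite
    length, and leaves the seminorms below the original lengths untouched, so
    that the separated case applies. *)

Set Implicit Arguments.
Unset Strict Implicit.
Unset Printing Implicit Defensive.

Import Order.TTheory GRing.Theory Num.Theory.
Import numFieldNormedType.Exports.

Local Open Scope classical_set_scope.
Local Open Scope ring_scope.

(** * Absolute values of scalars and seminorms *)

Lemma scalar_abs_triangle (R : realType) (s : scalars) (a b : scalar_field R s) :
  scalar_abs (a + b) <= scalar_abs a + scalar_abs b.
Proof.
case: s a b => a b /=; first exact: ler_normD.
exact: le_normcD.
Qed.

Lemma scalar_absM (R : realType) (s : scalars) (a b : scalar_field R s) :
  scalar_abs (a * b) = scalar_abs a * scalar_abs b.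
Proof.
case: s a b => a b /=; first exact: normrM.
exact: ComplexField.Normc.normcM.
Qed.

Lemma scalar_abs0 (R : realType) (s : scalars) :
  scalar_abs (0 : scalar_field R s) = 0.
Proof. by case: s => /=; [exact: normr0 | exact: ComplexField.Normc.normc0]. Qed.

Lemma scalar_abs1 (R : realType) (s : scalars) :
  scalar_abs (1 : scalar_field R s) = 1.
Proof. by case: s => /=; [exact: normr1 | exact: ComplexField.Normc.normc1]. Qed.

Lemma scalar_abs_eq0 (R : realType) (s : scalars) (a : scalar_field R s) :
  scalar_abs a = 0 -> a = 0.
Proof.
case: s a => a /=; first exact: normr0_eq0.
exact: ComplexField.Normc.eq0_normc.
Qed.

Lemma scalar_absN (R : realType) (s : scalars) (a : scalar_field R s) :
  scalar_abs (- a) = scalar_abs a.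
Proof.
case: s a => a /=; first exact: normrN.
exact: normcN.
Qed.

Lemma scalar_abs_ge0 (R : realType) (s : scalars) (a : scalar_field R s) :
  0 <= scalar_abs a.
Proof.
have := scalar_abs_triangle a (- a); rewrite subrr scalar_absN scalar_abs0.
lra.
Qed.

Section SeminormTheory.
Variables (R : realType) (s : scalars).
Implicit Types X V : lmodType (scalar_field R s).

Lemma seminorm0 X (p : X -> R) : is_seminorm p -> p 0 = 0.
Proof. by move=> [_ /(_ 0 0)]; rewrite scale0r scalar_abs0 mul0r. Qed.

Lemma seminormN X (p : X -> R) x : is_seminorm p -> p (- x) = p x.
Proof. by move=> [_ pZ]; rewrite -scaleN1r pZ scalar_absN scalar_abs1 mul1r. Qed.

Lemma seminorm_ge0 X (p : X -> R) x : is_seminorm p -> 0 <= p x.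
Proof.
move=> ps; have [pD _] := ps.
have := pD x (- x); rewrite subrr seminorm0// seminormN//; lra.
Qed.

Lemma seminorm_dist X (p : X -> R) x y : is_seminorm p -> p x <= p (x - y) + p y.
Proof. by move=> [pD _]; have := pD (x - y) y; rewrite subrK. Qed.

Lemma seminormMl X (p : X -> R) (c : R) :
  0 <= c -> is_seminorm p -> is_seminorm (fun x => c * p x).
Proof.
move=> c0 [pD pZ]; split=> [x y|a x]; last by rewrite pZ mulrCA.
by rewrite -mulrDr ler_wpM2l.
Qed.

Lemma seminormD X (p q : X -> R) :
  is_seminorm p -> is_seminorm q -> is_seminorm (fun x => p x + q x).
Proof.
move=> [pD pZ] [qD qZ]; split=> [x y|a x]; last by rewrite pZ qZ mulrDr.
have := pD x y; have := qD x y; lra.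
Qed.

Lemma seminorm_prod X V (p : X -> R) (q : V -> R) :
  is_seminorm p -> is_seminorm q ->
  is_seminorm (fun v : X * V => p v.1 + q v.2).
Proof.
move=> [pD pZ] [qD qZ]; split=> [x y|a x] /=; last by rewrite pZ qZ mulrDr.
have := pD x.1 y.1; have := qD x.2 y.2; lra.
Qed.

(** The infimal convolution of [p] with the image of [q] under [T]; also the
    quotient seminorm of [p v + q x] on [V * X] by the graph of [T]. *)
Definition infconv X V (T : X -> V) (p : V -> R) (q : X -> R) (v : V) : R :=
  inf [set p (v - T x) + q x | x in [set: X]].

Lemma infconv_le X V (T : X -> V) (p : V -> R) (q : X -> R) v x :
  is_seminorm p -> is_seminorm q -> infconv T p q v <= p (v - T x) + q x.
Proof.
move=> ps qs; apply: ge_inf; last by exists x.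
by exists 0 => _ [y _ <-]; rewrite addr_ge0// seminorm_ge0.
Qed.

Lemma infconv_ge X V (T : X -> V) (p : V -> R) (q : X -> R) v (m : R) :
  (forall x, m <= p (v - T x) + q x) -> m <= infconv T p q v.
Proof.
move=> mle; apply: lb_le_inf; first by exists (p (v - T 0) + q 0); exists 0.
by move=> _ [y _ <-].
Qed.

(** Homogeneity is an inequality for nonzero scalars, by rescaling the
    competitor, and the converse inequality is the same one for the inverse
    scalar. *)
Lemma infconv_seminorm X V (T : {linear X -> V}) (p : V -> R) (q : X -> R) :
  is_seminorm p -> is_seminorm q -> is_seminorm (infconv T p q).
Proof.
move=> ps qs; have [pD pZ] := ps; have [qD qZ] := qs.
have sc_le a v : a != 0 -> infconv T p q (a *: v) <= scalar_abs a * infconv T p q v.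
  move=> a0; have abs_a0 : 0 < scalar_abs a.
    rewrite lt_neqAle scalar_abs_ge0 andbT eq_sym.
    by apply: contra a0 => /eqP/scalar_abs_eq0 ->.
  rewrite -ler_pdivrMl//; apply: infconv_ge => x.
  rewrite ler_pdivrMl// mulrDr -pZ -qZ scalerBr -linearZ.
  exact: infconv_le.
split=> [v w|a v].
  rewrite -lerBlDr; apply: infconv_ge => x.
  rewrite lerBlDr [leRHS]addrC -lerBlDr; apply: infconv_ge => y; rewrite lerBlDr.
  apply: (le_trans (infconv_le T (v + w) (x + y) ps qs)).
  have -> : v + w - T (x + y) = (v - T x) + (w - T y).
    by rewrite linearD opprD addrACA.
  have := pD (v - T x) (w - T y); have := qD x y; lra.
have [->|a0] := eqVneq a 0.
  rewrite scale0r scalar_abs0 mul0r; apply/eqP; rewrite eq_le; apply/andP; split.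
    apply: (le_trans (infconv_le T 0 0 ps qs)).
    by rewrite linear0 subr0 !seminorm0// addr0.
  by apply: infconv_ge => x; rewrite addr_ge0// seminorm_ge0.
apply/eqP; rewrite eq_le sc_le//=.
have := sc_le a^-1 (a *: v); rewrite scalerA mulVf// scale1r => /(_ (invr_neq0 a0)).
move=> /(ler_wpM2l (scalar_abs_ge0 a)).
by rewrite mulrA -scalar_absM divff// scalar_abs1 mul1r.
Qed.

Lemma infconv_mono X V (T : X -> V) (p p' : V -> R) (q q' : X -> R) v :
  is_seminorm p -> is_seminorm q ->
  (forall w, p w <= p' w) -> (forall x, q x <= q' x) ->
  infconv T p q v <= infconv T p' q' v.
Proof.
move=> ps qs pp' qq'; apply: infconv_ge => x.
by apply: (le_trans (infconv_le T v x ps qs)); rewrite lerD.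
Qed.

(** The infimum is attained at [x = 0] when no [x] does better.  This is how
    the two inclusions into the amalgam are shown isometric. *)
Lemma infconv_id X V (T : {linear X -> V}) (p : V -> R) (q : X -> R) v :
  is_seminorm p -> is_seminorm q ->
  (forall x, p v <= p (v - T x) + q x) -> infconv T p q v = p v.
Proof.
move=> ps qs pv; apply/eqP; rewrite eq_le; apply/andP; split.
  apply: (le_trans (infconv_le T v 0 ps qs)).
  by rewrite linear0 subr0 (seminorm0 qs) addr0.
exact: infconv_ge.
Qed.

(** A seminorm below [p] that [T] maps boundedly into survives the infimum, up
    to a constant: [r v <= r (v - T x) + r (T x) <= p (v - T x) + b * q x].
    Separation of the amalgam rests on it. *)
Lemma infconv_dominates X V (T : X -> V) (p r : V -> R) (q : X -> R) (b : R) v :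
  is_seminorm p -> is_seminorm q -> is_seminorm r -> 0 <= b ->
  (forall w, r w <= p w) -> (forall x, r (T x) <= b * q x) ->
  r v <= (1 + b) * infconv T p q v.
Proof.
move=> ps qs rs b0 rp rT; have b1 : 0 < 1 + b by lra.
rewrite -ler_pdivrMl//; apply: infconv_ge => x; rewrite ler_pdivrMl//.
apply: (le_trans (seminorm_dist v (T x) rs)).
have := rp (v - T x); have := rT x.
have := seminorm_ge0 (v - T x) ps; have := seminorm_ge0 x qs; nra.
Qed.

(** The l1-norm in a fixed basis, witnessing that a finite-dimensional space
    carries a norm; it makes [sepext] separated. *)
Definition coord_norm (Y : vectType (scalar_field R s)) (y : Y) : R :=
  \sum_i scalar_abs (coord (vbasis fullv) i y).

Lemma coord_norm_seminorm (Y : vectType (scalar_field R s)) :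
  is_seminorm (@coord_norm Y).
Proof.
split=> [x y|a x].
  rewrite -big_split ler_sum// => i _.
  by rewrite linearD scalar_abs_triangle.
by rewrite mulr_sumr; apply: eq_bigr => i _; rewrite linearZ scalar_absM.
Qed.

Lemma coord_norm_eq0 (Y : vectType (scalar_field R s)) (y : Y) :
  coord_norm y = 0 -> y = 0.
Proof.
move=> /eqP; rewrite psumr_eq0; last by move=> i _; exact: scalar_abs_ge0.
move=> /allP y0; rewrite (coord_vbasis (memvf y)) big1// => i _.
rewrite (@scalar_abs_eq0 _ _ (coord _ i y)) ?scale0r//.
by apply/eqP/y0; rewrite mem_index_enum.
Qed.

End SeminormTheory.

(** * Lengths *)

Definition ordw_max (a b : ordw) : ordw := if ordw_le a b then b else a.

Lemma ordw_lt_max (n : nat) a b :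
  ordw_lt n (ordw_max a b) = ordw_lt n a || ordw_lt n b.
Proof.
rewrite /ordw_max; case: a => [a|]; case: b => [b|] //=;
  rewrite /ordw_lt /= ?orbT ?orbF//.
by case: leqP => /= ab; lia.
Qed.

Lemma ordw_le_maxl a b : ordw_le a (ordw_max a b).
Proof. by rewrite /ordw_max; case: ifP => // _; case: a => [a|] /=. Qed.

Lemma ordw_le_maxr a b : ordw_le b (ordw_max a b).
Proof.
rewrite /ordw_max; case: ifP => [_|]; first by case: b => [b|] /=.
by case: a => [a|]; case: b => [b|] //=; lia.
Qed.

Lemma ordw_le_ltn (n m : nat) a : (n <= m)%N -> ordw_lt m a -> ordw_lt n a.
Proof. by case: a => [a|]//; rewrite /ordw_lt /=; lia. Qed.

Lemma ordw_lt_le (n : nat) a b : ordw_le a b -> ordw_lt n a -> ordw_lt n b.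
Proof. by case: a => [a|]; case: b => [b|]//; rewrite /ordw_lt /=; lia. Qed.

(** Reindexing by [clamp l] repeats the last seminorm of a space of length [l]
    indefinitely, so that spaces of different lengths can be summed without
    losing gradedness. *)
Definition clamp (l : ordw) (n : nat) : nat :=
  if l is Fin k then minn n k.-1 else n.

Lemma clamp_lt l (n : nat) : ordw_le 1%N l -> ordw_lt (clamp l n) l.
Proof. by case: l => [k|]//; rewrite /ordw_lt /=; lia. Qed.

Lemma clamp_id l (n : nat) : ordw_lt n l -> clamp l n = n.
Proof. by case: l => [k|]//; rewrite /ordw_lt /=; lia. Qed.

Lemma clamp_mono l (n m : nat) : (n <= m)%N -> (clamp l n <= clamp l m)%N.
Proof. by case: l => [k|]//=; lia. Qed.

(** * The amalgam *)

Section Injections.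
Variables (F : fieldType) (Y Z : vectType F).

Definition pair_inl (y : Y) : Y * Z := (y, 0).
Definition pair_inr (z : Z) : Y * Z := (0, z).

Fact pair_inl_linear : linear pair_inl.
Proof. by move=> a u v; congr pair; rewrite /= scaler0 addr0. Qed.
Fact pair_inr_linear : linear pair_inr.
Proof. by move=> a u v; congr pair; rewrite /= scaler0 addr0. Qed.

HB.instance Definition _ := GRing.isLinear.Build F Y (Y * Z)%type _ pair_inl
  pair_inl_linear.
HB.instance Definition _ := GRing.isLinear.Build F Z (Y * Z)%type _ pair_inr
  pair_inr_linear.

Definition inl_hom : 'Hom(Y, (Y * Z)%type) := linfun pair_inl.
Definition inr_hom : 'Hom(Z, (Y * Z)%type) := linfun pair_inr.

Lemma inl_homE y : inl_hom y = (y, 0). Proof. by rewrite lfunE. Qed.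
Lemma inr_homE z : inr_hom z = (0, z). Proof. by rewrite lfunE. Qed.

Lemma inl_hom_inj : injective inl_hom.
Proof. by move=> y y'; rewrite !inl_homE => -[]. Qed.
Lemma inr_hom_inj : injective inr_hom.
Proof. by move=> z z'; rewrite !inr_homE => -[]. Qed.

(** The map [x |-> (f0 x, - f1 x)], written as the very difference whose
    operator norm an amalgam has to bound. *)
Definition gap (X : vectType F) (f0 : 'Hom(X, Y)) (f1 : 'Hom(X, Z)) :
    'Hom(X, (Y * Z)%type) :=
  (inl_hom \o f0)%VF - (inr_hom \o f1)%VF.

Lemma gapE (X : vectType F) (f0 : 'Hom(X, Y)) (f1 : 'Hom(X, Z)) x :
  gap f0 f1 x = (f0 x, - f1 x).
Proof.
rewrite /gap add_lfunE opp_lfunE !comp_lfunE inl_homE inr_homE.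
by congr pair; rewrite /= ?sub0r ?subr0.
Qed.

End Injections.

Section Amalgam.
Variables (R : realType) (s : scalars).
Implicit Types (X Y Z W : mspace R s) (b c delta eps : R) (n m : nat).

Definition sum_norm Y Z n (v : Y * Z) : R :=
  msnorm Y (clamp (mslen Y) n) v.1 + msnorm Z (clamp (mslen Z) n) v.2.

Lemma sum_norm_seminorm Y Z n : is_seminorm (@sum_norm Y Z n).
Proof.
apply: seminorm_prod; apply: msnorm_seminorm; apply: clamp_lt;
exact: mslen_ge1.
Qed.

Definition amalgam_norm X Y Z (f0 : 'Hom(X, Y)) (f1 : 'Hom(X, Z)) c
    n : Y * Z -> R :=
  if ordw_lt n (mslen X) then
    infconv (gap f0 f1) (@sum_norm Y Z n) (fun x => c * msnorm X n x)
  else @sum_norm Y Z n.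

Lemma scaled_seminorm X c n : 0 <= c -> ordw_lt n (mslen X) ->
  is_seminorm (fun x => c * msnorm X n x).
Proof. by move=> c0 nX; apply: seminormMl => //; exact: msnorm_seminorm. Qed.

Lemma amalgam_norm_seminorm X Y Z (f0 : 'Hom(X, Y)) (f1 : 'Hom(X, Z)) c n :
  0 <= c -> is_seminorm (amalgam_norm f0 f1 c n).
Proof.
move=> c0; rewrite /amalgam_norm; case: ifPn => nX; last exact: sum_norm_seminorm.
apply: (@infconv_seminorm R s X (Y * Z)%type (gap f0 f1)).
- exact: sum_norm_seminorm.
- exact: scaled_seminorm.
Qed.

Lemma ordw_max_ge1 X Y : ordw_le 1%N (ordw_max (mslen X) (mslen Y)).
Proof. by rewrite /ordw_max; case: ifP => _; exact: mslen_ge1. Qed.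

Definition amalgam X Y Z (f0 : 'Hom(X, Y)) (f1 : 'Hom(X, Z)) c
    (c0 : 0 <= c) : mspace R s :=
  @MSpace R s (Y * Z)%type (ordw_max (mslen Y) (mslen Z))
    (amalgam_norm f0 f1 c) (ordw_max_ge1 Y Z)
    (fun n _ => amalgam_norm_seminorm f0 f1 n c0).

Lemma sum_norm_graded Y Z n m v : graded Y -> graded Z -> (n <= m)%N ->
  @sum_norm Y Z n v <= @sum_norm Y Z m v.
Proof.
move=> gY gZ nm; rewrite /sum_norm lerD//.
- by apply: gY; [exact: clamp_mono | apply/clamp_lt/mslen_ge1].
- by apply: gZ; [exact: clamp_mono | apply/clamp_lt/mslen_ge1].
Qed.

(** The one delicate step is from an [n] below the length of [X] to an [m]
    beyond it, where an infimum is compared with a sum through its term at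
    [x = 0]. *)
Lemma amalgam_graded X Y Z (f0 : 'Hom(X, Y)) (f1 : 'Hom(X, Z)) c (c0 : 0 <= c) :
  graded X -> graded Y -> graded Z -> graded (amalgam f0 f1 c0).
Proof.
move=> gX gY gZ v n m nm _ /=; rewrite /amalgam_norm.
have sums : is_seminorm (@sum_norm Y Z n) by exact: sum_norm_seminorm.
case: ifPn => nX; case: ifPn => mX.
- apply: infconv_mono => //; first exact: scaled_seminorm.
    by move=> w; exact: sum_norm_graded.
  by move=> x; rewrite ler_wpM2l// gX.
- have qs := scaled_seminorm c0 nX.
  apply: (le_trans (infconv_le (gap f0 f1) v 0 sums qs)).
  by rewrite linear0 subr0 (seminorm0 qs) addr0 sum_norm_graded.
- by rewrite (ordw_le_ltn nm mX) in nX.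
- exact: sum_norm_graded.
Qed.

(** The distortions combine to [(1 + delta) - 1 / (1 + delta)], which is at most
    [2 * delta] because [(1 - delta) * (1 + delta) <= 1].  This is where the
    modulus of stability comes from. *)
Lemma multi_embedding_compare delta X Y Z (f0 : 'Hom(X, Y)) (f1 : 'Hom(X, Z)) x n :
  0 <= delta -> multi_embedding delta f0 -> multi_embedding delta f1 ->
  ordw_lt n (mslen X) ->
  msnorm Y n (f0 x) <= msnorm Z n (f1 x) + 2 * delta * msnorm X n x.
Proof.
move=> d0 [_ _ e0] [_ _ e1] nX.
have [_ up] := e0 x n nX; have [low _] := e1 x n nX.
have nx0 : 0 <= msnorm X n x by apply/seminorm_ge0/msnorm_seminorm.
apply: (le_trans up); rewrite -lerBlDr -mulrBl; apply: le_trans low.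
apply: ler_wpM2r => //.
have d1 : 0 < 1 + delta by lra.
(* What remains is [(1 + delta - 2 * delta) * (1 + delta) <= 1]. *)
rewrite -[leRHS]mul1r ler_pdivlMr//; nra.
Qed.

Lemma amalgam_norm_id X Y Z (f0 : 'Hom(X, Y)) (f1 : 'Hom(X, Z)) c n v :
  0 <= c ->
  (ordw_lt n (mslen X) -> forall x,
     @sum_norm Y Z n v <=
     @sum_norm Y Z n (v - gap f0 f1 x) + c * msnorm X n x) ->
  amalgam_norm f0 f1 c n v = @sum_norm Y Z n v.
Proof.
move=> c0 vle; rewrite /amalgam_norm; case: ifPn => // nX.
apply: (@infconv_id R s X (Y * Z)%type (gap f0 f1)).
- exact: sum_norm_seminorm.
- exact: scaled_seminorm.
- exact: vle.
Qed.

Lemma clamp_norm_seminorm Y n : is_seminorm (msnorm Y (clamp (mslen Y) n)).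
Proof. exact/msnorm_seminorm/clamp_lt/mslen_ge1. Qed.

Lemma sum_norm_inl Y Z n y : ordw_lt n (mslen Y) ->
  @sum_norm Y Z n (y, 0) = msnorm Y n y.
Proof.
move=> nY; rewrite /sum_norm /= (clamp_id nY).
by rewrite (seminorm0 (clamp_norm_seminorm Z n)) addr0.
Qed.

Lemma sum_norm_inr Y Z n z : ordw_lt n (mslen Z) ->
  @sum_norm Y Z n (0, z) = msnorm Z n z.
Proof.
move=> nZ; rewrite /sum_norm /= (clamp_id nZ).
by rewrite (seminorm0 (clamp_norm_seminorm Y n)) add0r.
Qed.

(** Moving a part [f0 x] of [y] to the other summand costs at least what it
    saves: it saves at most [|f0 x|], and costs [|f1 x| + c |x|]. *)
Lemma amalgam_inl_isometric delta X Y Z (f0 : 'Hom(X, Y)) (f1 : 'Hom(X, Z))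
    c (c0 : 0 <= c) : 0 <= delta -> 2 * delta <= c ->
  multi_embedding delta f0 -> multi_embedding delta f1 ->
  @multi_isometric R s Y (amalgam f0 f1 c0) (inl_hom Y Z).
Proof.
move=> d0 dc e0 e1; have [XZ _ _] := e1; split.
- exact: ordw_le_maxl.
- exact: inl_hom_inj.
- move=> y n nY; rewrite addr0 invr1 !mul1r /= inl_homE.
  rewrite amalgam_norm_id ?sum_norm_inl// => nX x; rewrite gapE.
  have nZ := ordw_lt_le XZ nX; have Xs := msnorm_seminorm nX.
  rewrite /sum_norm /= (clamp_id nY) (clamp_id nZ) sub0r opprK.
  have := multi_embedding_compare x d0 e0 e1 nX.
  have := seminorm_dist y (f0 x) (msnorm_seminorm nY).
  have := ler_wpM2r (seminorm_ge0 x Xs) dc.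
  lra.
Qed.

Lemma amalgam_inr_isometric delta X Y Z (f0 : 'Hom(X, Y)) (f1 : 'Hom(X, Z))
    c (c0 : 0 <= c) : 0 <= delta -> 2 * delta <= c ->
  multi_embedding delta f0 -> multi_embedding delta f1 ->
  @multi_isometric R s Z (amalgam f0 f1 c0) (inr_hom Y Z).
Proof.
move=> d0 dc e0 e1; have [XY _ _] := e0; split.
- exact: ordw_le_maxr.
- exact: inr_hom_inj.
- move=> z n nZ; rewrite addr0 invr1 !mul1r /= inr_homE.
  rewrite amalgam_norm_id ?sum_norm_inr// => nX x; rewrite gapE.
  have nY := ordw_lt_le XY nX; have Xs := msnorm_seminorm nX.
  have Zs := msnorm_seminorm nZ.
  rewrite /sum_norm /= (clamp_id nY) (clamp_id nZ) sub0r opprK.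
  rewrite (seminormN _ (msnorm_seminorm nY)).
  have := multi_embedding_compare x d0 e1 e0 nX.
  have := seminorm_dist z (- f1 x) Zs; rewrite opprK (seminormN _ Zs).
  have := ler_wpM2r (seminorm_ge0 x Xs) dc.
  lra.
Qed.

(** The competitor [x] in the infimum at [gap f0 f1 x] leaves only its own
    price [c |x|]. *)
Lemma amalgam_norm_gap X Y Z (f0 : 'Hom(X, Y)) (f1 : 'Hom(X, Z)) c n x :
  0 <= c -> ordw_lt n (mslen X) ->
  amalgam_norm f0 f1 c n (gap f0 f1 x) <= c * msnorm X n x.
Proof.
move=> c0 nX; rewrite /amalgam_norm nX.
have sums := sum_norm_seminorm Y Z n.
apply: (le_trans (infconv_le _ _ x sums (scaled_seminorm c0 nX))).
by rewrite subrr (seminorm0 sums) add0r.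
Qed.

(** Here [0 < c] is what matters: the bound [b |x|] on the gap is the multiple
    [b / c] of the price [c |x|]. *)
Lemma amalgam_norm_dominates X Y Z (f0 : 'Hom(X, Y)) (f1 : 'Hom(X, Z)) c b n
    (r : Y * Z -> R) v :
  0 < c -> 0 <= b -> is_seminorm r -> (forall w, r w <= @sum_norm Y Z n w) ->
  (forall x, ordw_lt n (mslen X) -> r (gap f0 f1 x) <= b * msnorm X n x) ->
  r v != 0 -> amalgam_norm f0 f1 c n v != 0.
Proof.
move=> c0 b0 rs rsum rgap; apply: contra => /eqP; rewrite /amalgam_norm => v0.
suff : r v <= 0 by rewrite eq_le seminorm_ge0// andbT.
move: v0; case: ifPn => nX v0; last by rewrite -v0.
have := @infconv_dominates R s X (Y * Z)%type (gap f0 f1) (@sum_norm Y Z n) r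
  (fun x => c * msnorm X n x) (b / c) v.
rewrite v0 mulr0; apply=> //.
- exact: sum_norm_seminorm.
- by apply: scaled_seminorm => //; exact: ltW.
- by rewrite divr_ge0// ltW.
- by move=> x; rewrite mulrA divfK ?gt_eqF//; exact: rgap.
Qed.

(** A nonzero [(y, z)] has a nonzero component, detected by a seminorm of [Y]
    or of [Z], which the amalgam seminorm of the same index dominates. *)
Lemma amalgam_separated delta X Y Z (f0 : 'Hom(X, Y)) (f1 : 'Hom(X, Z))
    c (c0 : 0 <= c) : 0 < c -> 0 <= delta ->
  multi_embedding delta f0 -> multi_embedding delta f1 ->
  Defs.separated Y -> Defs.separated Z -> Defs.separated (amalgam f0 f1 c0).
Proof.
move=> cpos d0 [XY _ e0] [XZ _ e1] sY sZ v v0.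
have d1 : 0 <= 1 + delta by lra.
have [y0|y0] := eqVneq v.1 0; last first.
  have [n nY yn0] := sY _ y0.
  exists n; first by rewrite /= ordw_lt_max nY.
  have Ys := msnorm_seminorm nY.
  apply: (@amalgam_norm_dominates X Y Z f0 f1 c (1 + delta) n
    (fun w => msnorm Y n w.1)) => //.
  - by have [YD YZ] := Ys; split=> [w w'|a w] /=; [exact: YD | exact: YZ].
  - move=> w; rewrite /sum_norm (clamp_id nY) lerDl.
    exact/seminorm_ge0/clamp_norm_seminorm.
  - by move=> x nX; rewrite gapE; have [] := e0 x n nX.
have z0 : v.2 != 0.
  by apply: contra v0 => /eqP z0; apply/eqP; case: v y0 z0 => /= ? ? -> ->.
have [n nZ zn0] := sZ _ z0.
exists n; first by rewrite /= ordw_lt_max nZ orbT.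
have Zs := msnorm_seminorm nZ.
apply: (@amalgam_norm_dominates X Y Z f0 f1 c (1 + delta) n
  (fun w => msnorm Z n w.2)) => //.
- by have [ZD ZZ] := Zs; split=> [w w'|a w] /=; [exact: ZD | exact: ZZ].
- move=> w; rewrite /sum_norm (clamp_id nZ) lerDr.
  exact/seminorm_ge0/clamp_norm_seminorm.
- by move=> x nX; rewrite gapE /= (seminormN _ Zs); have [] := e1 x n nX.
Qed.

(** Applies to the separated classes directly, and to spaces of finite length
    once [Y] and [Z] have been replaced by separated extensions, [X] staying
    as it is.  The parameter [eps] goes entirely into making the price
    [c = 2 * delta + eps] of [x] positive, which separation needs when
    [delta = 0]. *)
Lemma separated_amalgamation (K : msclass R s) eps delta X Y Z
    (f0 : 'Hom(X, Y)) (f1 : 'Hom(X, Z)) :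
  K = classM \/ K = classG -> 0 < eps -> 0 <= delta ->
  K X -> K Y -> K Z -> Defs.separated Y -> Defs.separated Z ->
  multi_embedding delta f0 -> multi_embedding delta f1 ->
  exists (W : mspace R s) (g0 : 'Hom(Y, W)) (g1 : 'Hom(Z, W)),
    [/\ K W /\ mslen W = ordw_max (mslen Y) (mslen Z), Defs.separated W,
        multi_isometric g0, multi_isometric g1
      & forall n, ordw_lt n (mslen X) ->
          (opnorm n ((g0 \o f0)%VF - (g1 \o f1)%VF)%R
             <= (2 * delta + eps)%:E)%E].
Proof.
move=> hK e0 d0 KX KY KZ sY sZ emb0 emb1.
have c0 : 0 < 2 * delta + eps by lra.
exists (amalgam f0 f1 (ltW c0)), (inl_hom Y Z), (inr_hom Y Z); split.
- split=> //; case: hK KX KY KZ => -> // gX gY gZ.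
  exact: amalgam_graded.
- exact: (amalgam_separated _ d0 emb0 emb1).
- by apply: (amalgam_inl_isometric _ d0 _ emb0 emb1); lra.
- by apply: (amalgam_inr_isometric _ d0 _ emb0 emb1); lra.
- move=> n nX; apply: ge_ereal_sup => _ [x /= x1 <-]; rewrite lee_fin.
  apply: (le_trans (amalgam_norm_gap f0 f1 x (ltW c0) nX)).
  by rewrite -[leRHS]mulr1 ler_wpM2l// ltW.
Qed.

(** * Passing to separated spaces *)

Definition ordw_succ (l : ordw) : ordw := if l is Fin k then k.+1 else Omega.

(** The coordinate norm alone would separate points; adding the last seminorm
    to it keeps the sequence graded. *)
Definition sepext_norm Y n (y : Y) : R :=
  if ordw_lt n (mslen Y) then msnorm Y n y
  else msnorm Y (clamp (mslen Y) n) y + coord_norm y.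

Lemma sepext_norm_seminorm Y n : is_seminorm (@sepext_norm Y n).
Proof.
rewrite /sepext_norm; case: (boolP (ordw_lt n (mslen Y))) => nY.
  exact: msnorm_seminorm.
by apply: seminormD; [exact: clamp_norm_seminorm | exact: coord_norm_seminorm].
Qed.

Lemma ordw_succ_ge1 l : ordw_le 1%N (ordw_succ l).
Proof. by case: l. Qed.

Definition sepext Y : mspace R s :=
  @MSpace R s Y (ordw_succ (mslen Y)) (@sepext_norm Y)
    (ordw_succ_ge1 (mslen Y)) (fun n _ => sepext_norm_seminorm Y n).

Lemma sepext_len_le Y : ordw_le (mslen Y) (mslen (sepext Y)).
Proof. by rewrite /=; case: (mslen Y) => [k|] //=. Qed.

Lemma sepext_separated Y : ordw_lt (mslen Y) Omega -> Defs.separated (sepext Y).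
Proof.
move=> finY y y0; case lenY: (mslen Y) finY => [k|]// _; exists k.
  by rewrite /= lenY /ordw_lt /= ltnn.
have -> : msnorm (sepext Y) k y =
    msnorm Y (clamp (mslen Y) k) y + coord_norm y.
  by rewrite /= /sepext_norm [X in ordw_lt _ X]lenY /ordw_lt /= leqnn.
have := seminorm_ge0 y (clamp_norm_seminorm Y k).
have : coord_norm y != 0 by apply: contra y0 => /eqP/coord_norm_eq0 ->.
have := seminorm_ge0 y (coord_norm_seminorm Y).
lra.
Qed.

Lemma sepext_graded Y : graded Y -> graded (sepext Y).
Proof.
move=> gY y n m nm _ /=; rewrite /sepext_norm.
have cm : msnorm Y (clamp (mslen Y) n) y <= msnorm Y (clamp (mslen Y) m) y.
  by apply: gY; [exact: clamp_mono | apply/clamp_lt/mslen_ge1].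
have [nY|nY] := ifPn; have [mY|mY] := ifPn.
- exact: gY.
- rewrite (clamp_id nY) in cm; apply: (le_trans cm).
  by rewrite lerDl; exact/seminorm_ge0/coord_norm_seminorm.
- by rewrite (ordw_le_ltn nm mY) in nY.
- by rewrite lerD2r.
Qed.

Lemma sepext_embedding delta X Y (f : 'Hom(X, Y)) :
  multi_embedding delta f -> @multi_embedding R s delta X (sepext Y) f.
Proof.
move=> [XY f_inj fe]; split=> //.
- by move: XY => /=; case: (mslen X) => [a|]; case: (mslen Y) => [b|]//=; lia.
- by move=> x n nX /=; rewrite /sepext_norm (ordw_lt_le XY nX); exact: fe.
Qed.

Lemma sepext_isometric Y W (g : 'Hom(Y, W)) :
  @multi_isometric R s (sepext Y) W g -> multi_isometric g.
Proof.
move=> [YW g_inj ge]; split=> //.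
- move: YW => /=.
  by case: (mslen Y) => [a|]; case: (mslen W) => [b|]//=; lia.
- move=> y n nY; have := ge y n (ordw_lt_le (sepext_len_le Y) nY).
  by rewrite /= /sepext_norm nY.
Qed.

(** * The amalgamation classes *)

Definition zero_space (l : ordw) (l1 : ordw_le 1%N l) : mspace R s :=
  @MSpace R s 'rV[scalar_field R s]_0 l (fun _ => @coord_norm R s _) l1
    (fun _ _ => coord_norm_seminorm _).

Lemma zero_space_dim l (l1 : ordw_le 1%N l) : \dim {: zero_space l1} = 0%N.
Proof. by rewrite dimvf dim_matrix. Qed.

Lemma zero_space_separated l (l1 : ordw_le 1%N l) : Defs.separated (zero_space l1).
Proof. by move=> x; rewrite (thinmx0 x) eqxx. Qed.

Lemma zero_space_class (K : msclass R s) l (l1 : ordw_le 1%N l) :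
  K = classM \/ K = classG -> K (zero_space l1).
Proof. by case=> ->. Qed.

Lemma double_is_modulus : @is_modulus R (fun _ _ delta => 2 * delta).
Proof.
move=> d l _ _; split=> [t t0|t u t0 tu||].
- by rewrite mulr_ge0.
- by rewrite ltr_pM2l.
- by rewrite mulr0.
- rewrite -[X in _ --> X](mulr0 (2 : R)).
  exact/cvg_at_right_filter/mulrl_continuous.
Qed.

(** The three separated classes differ only in the condition [L] on lengths;
    since the length of an amalgam is the larger of the lengths of its two
    factors, closure of [L] under maxima is what keeps the amalgam in the
    class. *)
Lemma separated_amalgamation_class (K : msclass R s) (L : ordw -> Prop) l :
  K = classM \/ K = classG -> ordw_le 1%N l -> L l ->
  (forall l1 l2, L l1 -> L l2 -> L (ordw_max l1 l2)) ->
  amalgamation_class (fun X => class_sep K X /\ L (mslen X))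
    (fun _ _ delta => 2 * delta).
Proof.
move=> hK l1 Ll Lmax; split; first exact: double_is_modulus.
  exists (zero_space l1); last exact: zero_space_dim.
  by split=> //; split; [exact: zero_space_class | exact: zero_space_separated].
move=> d k eps delta _ _ e0 d0 X Y Z [[KX _] _] [[KY sY] LY] [[KZ sZ] LZ] _ _.
move=> f0 f1 emb0 emb1.
have [W [g0 [g1 [[KW lenW] sW iso0 iso1 op]]]] :=
  separated_amalgamation hK e0 d0 KX KY KZ sY sZ emb0 emb1.
exists W, g0, g1; split=> //; split=> //.
by rewrite lenW; exact: Lmax.
Qed.

(** [Y] and [Z] are replaced by their separated extensions.  An isometric
    embedding of the extension is one of the original space, and the lengths
    remain finite. *)
Lemma finite_length_amalgamation_class (K : msclass R s) :
  K = classM \/ K = classG ->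
  amalgamation_class (class_lt K Omega) (fun _ _ delta => 2 * delta).
Proof.
move=> hK; split; first exact: double_is_modulus.
  have l1 : ordw_le 1%N 1%N by [].
  exists (zero_space l1); last exact: zero_space_dim.
  by split=> //; exact: zero_space_class.
move=> d k eps delta _ _ e0 d0 X Y Z [KX _] [KY finY] [KZ finZ] _ _.
move=> f0 f1 emb0 emb1.
have Ksep U : K U -> K (sepext U).
  by case: hK => -> //; exact: sepext_graded.
have [W [g0 [g1 [[KW lenW] sW iso0 iso1 op]]]] :=
  separated_amalgamation hK e0 d0 KX (Ksep _ KY) (Ksep _ KZ)
    (sepext_separated finY) (sepext_separated finZ)
    (sepext_embedding emb0) (sepext_embedding emb1).
exists W, g0, g1; split=> //; [split=> // | exact: sepext_isometric..].
rewrite lenW /=; case: (mslen Y) finY => [a|]//; case: (mslen Z) finZ => [b|]//.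
by rewrite /ordw_max; case: ifP.
Qed.

End Amalgam.

Theorem proposition2p3 (R : realType) (s : scalars) (K : msclass R s)
    (hK : K = classM \/ K = classG) :
  (forall alpha : ordw,
    [/\ ordw_le 1%N alpha ->
          amalgamation_class (class_eq (class_sep K) alpha)
            (fun _ _ delta => 2 * delta),
        ordw_le 1%N alpha ->
          amalgamation_class (class_le (class_sep K) alpha)
            (fun _ _ delta => 2 * delta)
      & ordw_lt 1%N alpha ->
          amalgamation_class (class_lt (class_sep K) alpha)
            (fun _ _ delta => 2 * delta)]) /\
  amalgamation_class (class_lt K Omega) (fun _ _ delta => 2 * delta).
Proof.
split; last exact: finite_length_amalgamation_class.
move=> alpha; split=> alpha1.
- apply: (@separated_amalgamation_class R s K (fun l => l = alpha) alpha) => //.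
  by move=> a b -> ->; rewrite /ordw_max; case: ifP.
- apply: (@separated_amalgamation_class R s K (fun l => ordw_le l alpha) 1%N) => //.
  by move=> a b alpha_a alpha_b; rewrite /ordw_max; case: ifP.
- apply: (@separated_amalgamation_class R s K (fun l => ordw_lt l alpha) 1%N) => //.
  by move=> a b alpha_a alpha_b; rewrite /ordw_max; case: ifP.
Qed.
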